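(* Let $J:L_1(S)\rightrightarrows L_\infty(S)$ be the normalized duality mapping of the real Banach space $L_1(S)$. Let $f\in L_1(S)$ with $\mu\{s\in S: f(s)=0\}=0$. Then $J(f)$ is a singleton and satisfies $$\widehat{D}^*J(f,J(f))(\theta^{**})=\{\theta^*\}.$$
   Context: $(S,\mathcal A,\mu)$ is a positive and complete measure space; it is a standing convention that the real Banach space $(L_1(S),\|\cdot\|_1)$ has dual space $L_1(S)^*=(L_\infty(S),\|\cdot\|_\infty)$ via $\langle k^*,f\rangle=\int_S k^*(s)f(s)\,\mu(ds)$, and that $L_1(S)$ and $L_\infty(S)$ are not reflexive. $\langle\cdot,\cdot\rangle_*$ is the pairing between $L_\infty(S)^*$ (identified in the paper with a space $ba(S,\mathcal A)$ of bounded finitely additive set functions acting by integration) and $L_\infty(S)$. $\theta,\theta^*,\theta^{**}$ are the origins of $L_1(S),L_\infty(S),L_\infty(S)^*$. The normalized duality mapping is $J(f)=\{f^*\in L_\infty(S):\langle f^*,f\rangle=\|f\|_1^2=\|f^*\|_\infty^2\}$; when $J(f)$ is a singleton it is identified with its unique element. For $f\in L_1(S)$, $f^*\in J(f)$, the Mordukhovich derivative of $J$ at $(f,f^* )$ is defined, for $\gamma\in L_\infty(S)^*$, by $$\widehat{D}^*J(f,f^* )(\gamma)=\left\{k^*\in L_\infty(S):\ \limsup_{(g,g^* )\to(f,f^* ),\ g\in L_1(S),\ g^*\in J(g)}\frac{\langle k^*,g-f\rangle-\langle\gamma,g^*-f^*\rangle_*}{\|g-f\|_1+\|g^*-f^*\|_\infty}\le0\right\},$$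 with convergence in the norms and $(g,g^* )\ne(f,f^* )$. *)

(* Defs.v *)
From HB Require Import structures.
From mathcomp Require Import all_boot all_order all_algebra.
From mathcomp Require Import all_classical all_reals all_analysis.
From mathcomp Require Import measurable_realfun ess_sup_inf.

Set Implicit Arguments.
Unset Strict Implicit.
Unset Printing Implicit Defensive.

Import Order.TTheory GRing.Theory Num.Theory.
Import numFieldNormedType.Exports.

Local Open Scope classical_set_scope.
Local Open Scope ring_scope.

(* The library type [LspaceType mu p1] (classes of functions modulo equality
   almost everywhere) carries no algebraic structure: it is made here into a
   normed space. *)
Section Lspace_normed.
Context d (T : measurableType d) (R : realType).
Variables (mu : {measure set T -> \bar R}) (p : \bar R) (p1 : (1 <= p)%E).

Notation Lsp := (LspaceType mu p1).
Notation Lf := (LfunType mu p1).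

Lemma Lspace_eqP (f g : Lsp) :
  f = g <-> (f : T -> R) = (g : T -> R) %[ae mu].
Proof.
split=> [->|]; first exact: ae_eq_refl.
case: f => f [[fP]]; case: g => g [[gP]] /= fg.
have fgE : f = g.
  rewrite -(reprK f) -(reprK g); apply/eqmodP; exact/asboolP.
by subst g; rewrite (Prop_irrelevance fP gP).
Qed.

HB.instance Definition _ := gen_eqMixin Lsp.
HB.instance Definition _ := gen_choiceMixin Lsp.

Lemma Lrep_subproof (f : Lsp) : (f : T -> R) \in Lfun mu p.
Proof.
apply/andP; split; rewrite inE /=; last exact: Lebesgue_finite.
exact: (@measurable_funPT _ _ _ _ (repr (f : {mfun_ mu, T >-> measurableTypeR R}))).
Qed.

Definition Lrep (f : Lsp) : Lf := Lfun_Sub p1 (Lrep_subproof f).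

Lemma LrepE (f : Lsp) : (Lrep f : T -> R) = f.
Proof. by []. Qed.

(* [measurableTypeR R] and [R] carry the same sigma-algebra under two distinct
   displays. *)
Definition Lmfun (f : Lf) : {mfun T >-> measurableTypeR R} :=
  HB.pack_for {mfun T >-> measurableTypeR R} (f : T -> measurableTypeR R)
    (@isMeasurableFun.Build _ _ T (measurableTypeR R) f
       (@measurable_funPT _ _ _ _ f)).

Definition Lpi (f : Lf) : {mfun_ mu, T >-> measurableTypeR R} :=
  (\pi_{mfun_ mu, T >-> measurableTypeR R} (Lmfun f))%qT.

Lemma Lpi_ae (f : Lf) : (Lpi f : T -> R) = (f : T -> R) %[ae mu].
Proof.
rewrite /Lpi /aqEqMfun_to_fun.
by case: piP => g /eqmodP /asboolP /ae_eq_sym.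
Qed.

Lemma Lnorm_ae (f g : T -> R) :
  measurable_fun setT f -> measurable_fun setT g -> f = g %[ae mu] ->
  ('N[mu]_p[EFin \o f] = 'N[mu]_p[EFin \o g])%E.
Proof.
move=> mf mg fg; case: p p1 => [r||//] ?; rewrite unlock /Lnorm.
  congr (_ `^ _)%E; apply: ae_eq_integral => //.
  - apply/measurable_EFinP; apply: (measurableT_comp (measurable_powR _)) => //.
    exact: measurableT_comp.
  - apply/measurable_EFinP; apply: (measurableT_comp (measurable_powR _)) => //.
    exact: measurableT_comp.
  - by apply: filterS fg => x /(_ I) fgx _ /=; rewrite fgx.
case: ifP => // _; apply: eq_ess_sup.
by apply: filterS fg => x /(_ I) fgx /=; rewrite fgx.
Qed.

Lemma Lclass_subproof (f : Lf) : finite_norm mu p (Lpi f).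
Proof.
rewrite /finite_norm (_ : 'N[mu]_p[_] = 'N[mu]_p[EFin \o f])%E.
  exact: Lfunction_finite.
apply: Lnorm_ae => //; last exact: Lpi_ae.
exact: (@measurable_funPT _ _ _ _ (repr (Lpi f))).
Qed.


Definition Lclass (f : Lf) : Lsp :=
  HB.pack_for Lsp (Lpi f) (isFinLebesgue.Build _ _ _ _ _ p1 _ (Lclass_subproof f)).

Lemma Lclass_ae (f : Lf) : (Lclass f : T -> R) = (f : T -> R) %[ae mu].
Proof. exact: Lpi_ae. Qed.


Let add f g := Lclass (Lrep f + Lrep g).
Let opp f := Lclass (- Lrep f).
Let zero := Lclass 0.
Let scale a f := Lclass (a *: Lrep f).
Let nm (f : Lsp) := fine ('N[mu]_p[EFin \o (f : T -> R)])%E.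

Let add_ae f g : (add f g : T -> R) = (f : T -> R) \+ g %[ae mu].
Proof. exact: Lclass_ae. Qed.
Let opp_ae f : (opp f : T -> R) = \- (f : T -> R) %[ae mu].
Proof. exact: Lclass_ae. Qed.
Let zero_ae : (zero : T -> R) = \0 %[ae mu].
Proof. exact: Lclass_ae. Qed.
Let scale_ae a f : (scale a f : T -> R) = a \*: (f : T -> R) %[ae mu].
Proof. exact: Lclass_ae. Qed.

Let aeI (P Q : T -> Prop) : (\forall x \ae mu, P x) ->
  (\forall x \ae mu, Q x) -> \forall x \ae mu, P x /\ Q x.
Proof. by move=> aeP aeQ; apply: filterI. Qed.

Let addA : associative add.
Proof.
move=> f g h; apply/Lspace_eqP.
have A1 := aeI (add_ae f (add g h)) (add_ae g h).
have A2 := aeI (add_ae (add f g) h) (add_ae f g).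
move: A1 A2.
apply: filterS2 => x [e1 e2] [e3 e4] _.
by rewrite e1// e3//= e2// e4//= addrA.
Qed.

Let addC : commutative add.
Proof.
move=> f g; apply/Lspace_eqP; move: (add_ae f g) (add_ae g f).
by apply: filterS2 => x e1 e2 _; rewrite e1// e2//= addrC.
Qed.

Let add0 : left_id zero add.
Proof.
move=> f; apply/Lspace_eqP; move: (add_ae zero f) zero_ae.
by apply: filterS2 => x e1 e2 _; rewrite e1//= e2//= add0r.
Qed.

Let addN : left_inverse zero opp add.
Proof.
move=> f; apply/Lspace_eqP; move: (add_ae (opp f) f) (opp_ae f) zero_ae.
by apply: filterS3 => x e1 e2 e3 _; rewrite e1//= e2//= e3//= addNr.
Qed.

HB.instance Definition _ := GRing.isZmodule.Build Lsp addA addC add0 addN.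

Let scaleA a b f : scale a (scale b f) = scale (a * b) f.
Proof.
apply/Lspace_eqP.
move: (scale_ae a (scale b f)) (scale_ae b f) (scale_ae (a * b) f).
by apply: filterS3 => x e1 e2 e3 _; rewrite e1//= e2//= e3//= scalerA.
Qed.

Let scale1 : left_id 1 scale.
Proof.
move=> f; apply/Lspace_eqP; move: (scale_ae 1 f).
by apply: filterS => x e1 _; rewrite e1//= scale1r.
Qed.

Let scaleDr : right_distributive scale +%R.
Proof.
move=> a f g; apply/Lspace_eqP.
move: (aeI (scale_ae a (f + g)) (add_ae f g)) (add_ae (scale a f) (scale a g))
  (aeI (scale_ae a f) (scale_ae a g)).
apply: filterS3 => x [e1 e2] e3 [e4 e5] _.
by rewrite e1//= e2//= e3//= e4//= e5//= scalerDr.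
Qed.

Let scaleDl f : {morph scale^~ f : a b / a + b}.
Proof.
move=> a b; apply/Lspace_eqP.
move: (aeI (scale_ae (a + b) f) (add_ae (scale a f) (scale b f)))
  (aeI (scale_ae a f) (scale_ae b f)).
apply: filterS2 => x [e1 e2] [e3 e4] _.
by rewrite e1//= e2//= e3//= e4//= scalerDl.
Qed.

HB.instance Definition _ :=
  GRing.Zmodule_isLmodule.Build R Lsp scaleA scale1 scaleDr scaleDl.

Lemma Lspace_measurable (f : Lsp) : measurable_fun setT (f : T -> R).
Proof. exact: (@measurable_funPT _ _ _ _ (Lrep f)). Qed.

Lemma Lspace_add_ae (f g : Lsp) : (f + g : T -> R) = (f : T -> R) \+ g %[ae mu].
Proof. exact: add_ae. Qed.

Lemma Lspace_opp_ae (f : Lsp) : (- f : T -> R) = \- (f : T -> R) %[ae mu].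
Proof. exact: opp_ae. Qed.

Lemma Lspace_zero_ae : ((0 : Lsp) : T -> R) = \0 %[ae mu].
Proof. exact: zero_ae. Qed.

Lemma Lspace_scale_ae a (f : Lsp) :
  ((a *: f : Lsp) : T -> R) = a \*: (f : T -> R) %[ae mu].
Proof. exact: scale_ae. Qed.

Let nm_class (f : Lf) : nm (Lclass f) = fine ('N[mu]_p[EFin \o f])%E.
Proof.
by congr fine; apply: Lnorm_ae => //; [exact: Lspace_measurable|exact: Lclass_ae].
Qed.

Let nmD f g : nm (f + g) <= nm f + nm g.
Proof. by rewrite nm_class; exact: (ler_LnormD (Lrep f) (Lrep g)). Qed.

Let nmZ a f : nm (a *: f) = `|a| * nm f.
Proof.
rewrite nm_class; apply/EFin_inj; rewrite finite_norm_fine LnormZ EFinM.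
by congr (_ * _)%E; rewrite -(finite_norm_fine (Lrep f)).
Qed.

Let nm0 f : nm f = 0 -> f = 0.
Proof.
move=> /(@fine_Lnormr_eq0 _ _ _ _ _ p1 (Lrep f)) f0; apply/Lspace_eqP.
move: f0 Lspace_zero_ae.
by apply: filterS2 => x e1 e2 _; rewrite -(LrepE f) e1// e2.
Qed.

HB.instance Definition _ := Lmodule_isNormed.Build R Lsp nmD nmZ nm0.

Lemma Lspace_normE (f : Lsp) : `|f| = fine ('N[mu]_p[EFin \o (f : T -> R)])%E.
Proof. by []. Qed.

End Lspace_normed.

Section dual.
Context (R : realType) (V : normedModType R).

Definition continuous_linear : {pred V -> R^o} :=
  mem [set phi : V -> R^o | linear phi /\ continuous phi].

Lemma continuous_linear_submod_closed : submod_closed continuous_linear.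
Proof.
split=> [|a phi psi].
  rewrite inE; split=> [b u v|v]; last exact: cvg_cst.
  by rewrite /= scaler0 addr0.
rewrite !inE => -[lphi cphi] [lpsi cpsi]; split=> [b u v|v].
  rewrite -![(_ + _) _]/(_ + _) -![(a *: phi) _]/(a *: _) lphi lpsi.
  by rewrite !scalerDr !scalerA [b * a]mulrC addrACA.
by apply: cvgD; [apply: cvgZr; exact: cphi|exact: cpsi].
Qed.

HB.instance Definition _ := GRing.isSubmodClosed.Build R (V -> R^o)
  continuous_linear continuous_linear_submod_closed.

Record dual := Dual {
  dual_fun :> V -> R^o;
  dual_funP : dual_fun \in continuous_linear }.

HB.instance Definition _ := [isSub for dual_fun].
HB.instance Definition _ := [Choice of dual by <:].
HB.instance Definition _ := [SubChoice_isSubLmodule of dual by <:].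

Lemma dual_linear (phi : dual) : linear phi.
Proof. by have /[!inE] -[] := dual_funP phi. Qed.

Lemma dual_continuous (phi : dual) : continuous phi.
Proof. by have /[!inE] -[] := dual_funP phi. Qed.

HB.instance Definition _ (phi : dual) :=
  GRing.isLinear.Build R V R^o _ phi (dual_linear phi).

Lemma dualP (phi psi : dual) : phi =1 psi <-> phi = psi.
Proof. by split=> [pp|->//]; apply/val_inj/funext. Qed.

Lemma dual_addE (phi psi : dual) v : (phi + psi) v = phi v + psi v.
Proof. by []. Qed.

Lemma dual_scaleE a (phi : dual) v : (a *: phi) v = a * phi v.
Proof. by []. Qed.

Lemma dual_zeroE v : (0 : dual) v = 0.
Proof. by []. Qed.

Let unit_values (phi : dual) := [set `|phi v| | v in [set v : V | `|v| <= 1]].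
Let nm (phi : dual) : R := sup (unit_values phi).

Let has_sup_unit_values phi : has_sup (unit_values phi).
Proof.
split; first by exists `|phi 0|, 0 => //=; rewrite normr0.
have /continuous_linear_bounded/linear_boundedP : {for 0, continuous phi}.
  exact: dual_continuous.
move=> /pinfty_ex_gt0[r r0 phir]; exists r => _ [v /= v1 <-].
by rewrite (le_trans (phir v))// ler_piMr// ltW.
Qed.

Let le_nm (phi : dual) v : `|v| <= 1 -> `|phi v| <= nm phi.
Proof. by move=> v1; apply: sup_upper_bound; [exact: has_sup_unit_values|exists v]. Qed.

Let nm_le (phi : dual) r : (forall v, `|v| <= 1 -> `|phi v| <= r) -> nm phi <= r.
Proof.
move=> phir; apply: sup_le_ub; first by case: (has_sup_unit_values phi).
by move=> _ [v v1 <-]; exact: phir.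
Qed.

Let nmD phi psi : nm (phi + psi) <= nm phi + nm psi.
Proof.
apply: nm_le => v v1; rewrite dual_addE (le_trans (ler_normD _ _))//.
by rewrite lerD// le_nm.
Qed.

Let nmZ_le a phi : nm (a *: phi) <= `|a| * nm phi.
Proof.
by apply: nm_le => v v1; rewrite dual_scaleE normrM ler_wpM2l// le_nm.
Qed.

Let nm00 : nm 0 = 0.
Proof.
apply/eqP; rewrite eq_le; apply/andP; split.
  by apply: nm_le => v _; rewrite dual_zeroE normr0.
by rewrite (le_trans _ (@le_nm 0 0 _))// normr0.
Qed.

Let nmZ a phi : nm (a *: phi) = `|a| * nm phi.
Proof.
have [->|a0] := eqVneq a 0; first by rewrite scale0r normr0 mul0r nm00.
apply/eqP; rewrite eq_le nmZ_le/= -ler_pdivlMl ?normr_gt0//.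
by rewrite -normfV -{1}[phi](scalerK a0) nmZ_le.
Qed.

Let nm0 phi : nm phi = 0 -> phi = 0.
Proof.
move=> phi0; apply/dualP => v; rewrite dual_zeroE.
have [->|v0] := eqVneq v 0; first by rewrite linear0.
have : `|phi (`|v|^-1 *: v)| <= 0.
  by rewrite -phi0 le_nm// normrZ normfV normr_id mulVf// normr_eq0.
by rewrite normr_le0 linearZ/= scaler_eq0 invr_eq0 normr_eq0 (negbTE v0) => /eqP.
Qed.

HB.instance Definition _ := Lmodule_isNormed.Build R dual nmD nmZ nm0.

Lemma dual_normE (phi : dual) :
  `|phi| = sup [set `|phi v| | v in [set v : V | `|v| <= 1]].
Proof. by []. Qed.

End dual.

Definition reflexive_space (R : realType) (V : normedModType R) :=
  forall Phi : dual (dual V), exists v : V, forall phi : dual V, Phi phi = phi v.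

Section L1_Linfty.
Context d (T : measurableType d) (R : realType) (mu : {measure set T -> \bar R}).

Definition L1 := LspaceType mu (lexx (1%:E : \bar R)).
Definition Linfty := LspaceType mu (leey (1%:E : \bar R)).

HB.instance Definition _ := NormedModule.on L1.
HB.instance Definition _ := NormedModule.on Linfty.

Definition pairing (k : Linfty) (f : L1) : R := (\int[mu]_s (k s * f s))%R.

(* The map [iota] is unique, and linear because the pairing is bilinear. *)
Definition dual_L1_is_Linfty := exists iota : Linfty -> dual L1,
  [/\ bijective iota,
      forall k, `|iota k| = `|k| &
      forall k f, iota k f = pairing k f].

Definition duality_mapping (f : L1) : set Linfty :=
  [set k | pairing k f = `|f| ^+ 2 /\ `|f| ^+ 2 = `|k| ^+ 2].

Definition difference_quotient (f : L1) (f' : Linfty) (gamma : dual Linfty)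
    (k : Linfty) (z : L1 * Linfty) : R :=
  (pairing k (z.1 - f) - gamma (z.2 - f')) / (`|z.1 - f| + `|z.2 - f'|).

(* The filter is that of the punctured norm neighbourhoods of [(f, f')],
   restricted to the graph of the duality mapping.  The bidual functional
   [gamma] acts on [Linfty] directly, in place of the finitely additive set
   function representing it by integration. *)
Definition mordukhovich_derivative (f : L1) (f' : Linfty) (gamma : dual Linfty) :
    set Linfty :=
  [set k | (limf_esup (EFin \o difference_quotient f f' gamma k)
             (within [set z | duality_mapping z.1 z.2] (f, f')^') <= 0)%E].

End L1_Linfty.

(* Main.v *)
Require Import Defs.
From mathcomp Require Import all_boot all_order all_algebra.
From mathcomp Require Import all_classical all_reals all_analysis.
From mathcomp Require Import measurable_realfun ess_sup_inf.
From mathcomp Require Import ring.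

(** Let [f] vanish almost nowhere, and write ‖.‖ for norms and |.| for pointwise
    absolute values.  Equality in Hölder's inequality <k, f> <= ‖k‖ ‖f‖ forces
    k f = ‖k‖ |f| almost everywhere, so an element of J(f) must be ‖f‖ sgn f
    ([duality_mapping_sign]); conversely ‖f‖ sgn f is in J(f) for every [f]
    ([sign_duality_mapping]).

    That 0 belongs to the derivative in the direction 0 is clear, all the
    quotients being zero.  For the converse, the point is that the duality
    mapping has a Lipschitz selection along well chosen segments issuing from
    [f], although it is far from continuous.  If [h] is in L1 and |h| <= |f|
    almost everywhere, then for 0 < t < 1 the function g = f + t h has the sign
    of [f]: hence ‖g‖ sgn f is in J(g), and its distance to ‖f‖ sgn f is at most
    | ‖g‖ - ‖f‖ | <= ‖g - f‖.  The denominator of the difference quotient is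
    then at most 2 t ‖h‖, while its numerator is t <k, h>; letting t tend to 0,
    any [k] in the derivative satisfies <k, h> <= 0
    ([mordukhovich_derivative0_pairing_le0]).  For h = |f| sgn k the product
    k h = |k f| is nonnegative, so that k f = 0 almost everywhere, and k = 0
    because [f] vanishes almost nowhere. *)

Set Implicit Arguments.
Unset Strict Implicit.
Unset Printing Implicit Defensive.

Import Order.TTheory GRing.Theory Num.Theory.
Import numFieldNormedType.Exports.

Local Open Scope classical_set_scope.
Local Open Scope ring_scope.

(** * Signs, and integrals of functions that are nonnegative almost everywhere *)

(** This is what keeps the duality mapping under control on the segment from
    [f] to [f + h] when [h] is dominated by [f]. *)
Lemma sgr_perturb (R : realDomainType) (x y t : R) :
  0 <= t < 1 -> `|y| <= `|x| -> Num.sg (x + t * y) = Num.sg x.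
Proof.
move=> /andP[t0 t1]; have [x0|x0|->] := ltgtP x 0.
- rewrite (ltr0_norm x0) ler_norml opprK => /andP[xy yx].
  rewrite !ltr0_sg//.
  have : t * y <= t * - x by rewrite ler_wpM2l.
  have : (1 - t) * x < 0 by rewrite nmulr_llt0// subr_gt0.
  rewrite mulrBl mul1r mulrN => xt ty.
  by rewrite (le_lt_trans _ xt)// lerD2l.
- rewrite (gtr0_norm x0) ler_norml => /andP[xy yx].
  rewrite !gtr0_sg//.
  have : t * - x <= t * y by rewrite ler_wpM2l.
  have : 0 < (1 - t) * x by rewrite mulr_gt0// subr_gt0.
  rewrite mulrBl mul1r mulrN => xt ty.
  by rewrite (lt_le_trans xt)// lerD2l.
- by rewrite normr0 normr_le0 => /eqP->; rewrite mulr0 addr0.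
Qed.

Lemma ler_normrM_sg (R : realDomainType) (x y : R) : `|x * Num.sg y| <= `|x|.
Proof. by rewrite normrM ler_piMr// normr_sg lern1 leq_b1. Qed.

Section measure_prelims.
Context d (T : measurableType d) (R : realType) (mu : {measure set T -> \bar R}).

Lemma measurable_sgr (u : T -> R) :
  measurable_fun setT u -> measurable_fun setT (fun x => Num.sg (u x)).
Proof.
move=> u_meas; rewrite (_ : (fun x => _) = fun x =>
    if u x < 0 then -1 else if 0 < u x then 1 else 0).
  apply: measurable_fun_ifT => //; first exact: measurable_fun_ltr.
  by apply: measurable_fun_ifT => //; exact: measurable_fun_ltr.
by apply/funext => x; case: sgrP.
Qed.

Lemma ae_le_integrable (u v : T -> R) : measurable_fun setT u ->
  mu.-integrable setT (EFin \o v) -> (\forall x \ae mu, `|u x| <= `|v x|) ->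
  mu.-integrable setT (EFin \o u).
Proof.
move=> u_meas /integrableP[mv iv] uv.
apply/integrableP; split; first exact/measurable_EFinP.
apply: le_lt_trans iv; apply: ae_ge0_le_integral => //.
- by apply: measurableT_comp => //; exact/measurable_EFinP.
- exact: measurableT_comp.
- by apply: filterS uv => x + _; rewrite /= lee_fin.
Qed.

Lemma ae_eq_Rintegral (u v : T -> R) :
  measurable_fun setT u -> measurable_fun setT v -> u = v %[ae mu] ->
  (\int[mu]_x u x = \int[mu]_x v x)%R.
Proof.
move=> u_meas mv uv; congr fine; apply: ae_eq_integral => //;
  try exact/measurable_EFinP.
by apply: filterS uv => x /[apply] ->.
Qed.

Lemma ae_conj (P Q : T -> Prop) : (\forall x \ae mu, P x) ->
  (\forall x \ae mu, Q x) -> \forall x \ae mu, P x /\ Q x.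
Proof. by move=> aeP aeQ; apply: filterI. Qed.

Section ae_ge0.
Variable u : T -> R.
Hypothesis iu : mu.-integrable setT (EFin \o u).
Hypothesis u0 : \forall x \ae mu, 0 <= u x.

Let u_meas : measurable_fun setT u.
Proof. by case/integrableP : iu => /measurable_EFinP. Qed.

Let int_normr : (\int[mu]_x u x = \int[mu]_x `|u x|)%R.
Proof.
apply: ae_eq_Rintegral => //; first exact: measurableT_comp.
by apply: filterS u0 => x /ger0_norm ->.
Qed.

Lemma ae_Rintegral_ge0 : 0 <= (\int[mu]_x u x)%R.
Proof. by rewrite int_normr Rintegral_ge0. Qed.

Lemma ae_Rintegral_eq0 : (\int[mu]_x u x = 0)%R -> u = \0 %[ae mu].
Proof.
rewrite int_normr => uI.
have : (\int[mu]_x `|(EFin \o u) x| = 0)%E.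
  rewrite -[LHS]fineK; last first.
    by rewrite ge0_fin_numE ?integral_ge0//; case/integrableP : iu.
  by congr EFin.
have mEu : measurable_fun setT (EFin \o u) by exact/measurable_EFinP.
move=> /(ae_eq_integral_abs mu measurableT mEu).
by apply: filterS => x /[apply] -[].
Qed.
End ae_ge0.

End measure_prelims.

(** * The spaces L1 and Linfty and Hölder's inequality *)

Section L1_Linfty_theory.
Context d (T : measurableType d) (R : realType) (mu : {measure set T -> \bar R}).
Implicit Types (f g h : L1 mu) (k : Linfty mu).

Lemma Lfun_Lspace (p : \bar R) (p1 : (1 <= p)%E) (u : T -> R) :
  u \in Lfun mu p -> exists g : LspaceType mu p1, (g : T -> R) = u %[ae mu].
Proof. by move=> Lu; exists (Lclass (Lfun_Sub p1 Lu)); exact: Lclass_ae. Qed.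

Lemma L1_integrable f : mu.-integrable setT (EFin \o (f : T -> R)).
Proof. by apply/Lfun1_integrable; exact: Lrep_subproof. Qed.

Lemma L1_norm_integrable f :
  mu.-integrable setT (EFin \o (fun x => `|(f : T -> R) x|)).
Proof. by have := integrable_norm (L1_integrable f). Qed.

Lemma L1_normE f : `|f| = (\int[mu]_x `|(f : T -> R) x|)%R.
Proof. by rewrite [LHS]Lspace_normE Lnorm1. Qed.

Lemma Linfty_ae_le k : \forall x \ae mu, `|(k : T -> R) x| <= `|k|.
Proof.
(* For the zero measure the norm is zero by convention, and is not the
   essential supremum (which is then -oo); but there everything holds a.e. *)
have [mu0|mu0] := eqVneq (mu setT) 0%E.
  by exists setT; split.
have kE : (`|k|%:E = 'N[mu]_+oo%E[EFin \o (k : T -> R)])%E.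
  by rewrite [`|k|]Lspace_normE; exact: (finite_norm_fine (Lrep k)).
have := ess_sup_ge mu (abse \o (EFin \o (k : T -> R))).
apply: filterS => x; rewrite -lee_fin kE unlock lt_neqAle measure_ge0 eq_sym mu0.
exact.
Qed.

Lemma Linfty_norm_le k c : 0 <= c ->
  (\forall x \ae mu, `|(k : T -> R) x| <= c) -> `|k| <= c.
Proof.
move=> c0 kc; rewrite [`|k|]Lspace_normE -lee_fin.
rewrite (finite_norm_fine (Lrep k)) unlock; case: ifPn => // _.
by apply/ess_supP; apply: filterS kc => x; rewrite /= lee_fin.
Qed.

Lemma bounded_Linfty (u : T -> R) c : measurable_fun setT u ->
  (forall x, `|u x| <= c) -> exists k : Linfty mu, (k : T -> R) = u %[ae mu].
Proof.
move=> u_meas uc; apply: Lfun_Lspace; apply/andP; rewrite !inE/=; split => //.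
rewrite /finite_norm unlock; case: ifPn => // _.
apply: (@le_lt_trans _ _ c%:E); last exact: ltry.
by apply/ess_supP; apply: nearW => x /=; rewrite lee_fin.
Qed.

Lemma dominated_L1 f (u : T -> R) : measurable_fun setT u ->
  (forall x, `|u x| <= `|(f : T -> R) x|) ->
  exists g : L1 mu, (g : T -> R) = u %[ae mu].
Proof.
move=> u_meas uf; apply: Lfun_Lspace; apply/Lfun1_integrable.
by apply: ae_le_integrable u_meas (L1_integrable f) _; exact: nearW.
Qed.

Let scaled_norm_integrable k f :
  mu.-integrable setT (EFin \o (fun x => `|k| * `|(f : T -> R) x|)).
Proof.
have := integrableZl measurableT `|k| (L1_norm_integrable f).
by apply: eq_integrable => // x _; rewrite /= EFinM.
Qed.

Lemma measurable_pairing k f :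
  measurable_fun setT (fun x => (k : T -> R) x * (f : T -> R) x).
Proof. by apply: measurable_funM; exact: Lspace_measurable. Qed.

Lemma pairing_integrable k f :
  mu.-integrable setT (EFin \o (fun x => (k : T -> R) x * (f : T -> R) x)).
Proof.
apply: ae_le_integrable (measurable_pairing k f) (scaled_norm_integrable k f) _.
apply: filterS (Linfty_ae_le k) => x kx.
by rewrite !normrM !normr_id ler_wpM2r.
Qed.

Lemma pairingZr k f t : pairing k (t *: f) = t * pairing k f.
Proof.
rewrite /pairing -RintegralZl//; last exact: pairing_integrable.
apply: ae_eq_Rintegral; first exact: measurable_pairing.
  by apply: measurable_funM => //; exact: measurable_pairing.
apply: filterS (Lspace_scale_ae t f) => x fx _.
by rewrite fx//= mulrCA.
Qed.

Lemma pairing0l f : pairing (0 : Linfty mu) f = 0.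
Proof.
rewrite /pairing (@ae_eq_Rintegral _ _ _ _ _ (fun=> 0)) //.
- by rewrite /Rintegral integral0.
- exact: measurable_pairing.
- apply: filterS (Lspace_zero_ae mu (leey 1%:E)) => x x0 _.
  by rewrite x0//= mul0r.
Qed.

(** Hölder's inequality and its equality case both come from this integrand,
    which is nonnegative almost everywhere and whose integral is
    ‖k‖ ‖f‖ - <k, f>. *)
Definition holder_defect k f (x : T) : R :=
  `|k| * `|(f : T -> R) x| - (k : T -> R) x * (f : T -> R) x.

Lemma holder_defect_ge0 k f : \forall x \ae mu, 0 <= holder_defect k f x.
Proof.
apply: filterS (Linfty_ae_le k) => x kx; rewrite subr_ge0.
by rewrite (le_trans (ler_norm _))// normrM ler_wpM2r.
Qed.

Lemma holder_defect_integrable k f :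
  mu.-integrable setT (EFin \o holder_defect k f).
Proof.
have := integrableB measurableT (scaled_norm_integrable k f) (pairing_integrable k f).
by apply: eq_integrable => // x _; rewrite /= EFinB.
Qed.

Lemma Rintegral_holder_defect k f :
  (\int[mu]_x holder_defect k f x = `|k| * `|f| - pairing k f)%R.
Proof.
rewrite (RintegralB measurableT (scaled_norm_integrable k f) (pairing_integrable k f)).
by rewrite (RintegralZl _ measurableT (L1_norm_integrable f)) -L1_normE.
Qed.

Lemma pairing_le k f : pairing k f <= `|k| * `|f|.
Proof.
rewrite -subr_ge0 -Rintegral_holder_defect.
exact: ae_Rintegral_ge0 (holder_defect_integrable k f) (holder_defect_ge0 k f).
Qed.

Lemma holder_eq k f : pairing k f = `|k| * `|f| ->
  \forall x \ae mu, (k : T -> R) x * (f : T -> R) x = `|k| * `|(f : T -> R) x|.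
Proof.
move=> kf.
have := ae_Rintegral_eq0 (holder_defect_integrable k f) (holder_defect_ge0 k f).
rewrite Rintegral_holder_defect kf subrr => /(_ erefl).
by apply: filterS => x /(_ I) /eqP; rewrite subr_eq0 => /eqP ->.
Qed.

(** * The duality mapping of L1 *)

(** The function ‖f‖ sgn f is bounded by ‖f‖ and pairs with [f] to ‖f‖^2;
    Hölder's inequality then shows that its norm is no smaller than ‖f‖, which
    avoids computing an essential supremum. *)
Lemma sign_duality_mapping f k :
  (k : T -> R) = (fun x => `|f| * Num.sg ((f : T -> R) x)) %[ae mu] ->
  duality_mapping f k.
Proof.
move=> kE.
have kf : pairing k f = `|f| ^+ 2.
  rewrite expr2 {2}L1_normE -RintegralZl//; last exact: L1_norm_integrable.
  apply: ae_eq_Rintegral; first exact: measurable_pairing.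
    apply: measurable_funM => //.
    by apply: measurableT_comp => //; exact: Lspace_measurable.
  apply: filterS kE => x /(_ I) ->  _.
  by rewrite -mulrA -normrEsg.
split=> //; congr (_ ^+ 2); apply/eqP; rewrite eq_le; apply/andP; split.
  have [->//|f0] := eqVneq `|f| 0.
  by rewrite -(@ler_pM2r _ `|f|) ?lt0r ?f0//= -expr2 -kf pairing_le.
apply: Linfty_norm_le => //; apply: filterS kE => x /(_ I) ->.
by rewrite (le_trans (ler_normrM_sg _ _))// normr_id.
Qed.

Lemma exists_sign_duality_mapping f : exists2 k, duality_mapping f k &
  (k : T -> R) = (fun x => `|f| * Num.sg ((f : T -> R) x)) %[ae mu].
Proof.
have [||k kE] := @bounded_Linfty (fun x => `|f| * Num.sg ((f : T -> R) x)) `|f|.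
- apply: measurable_funM => //; apply: measurable_sgr.
  exact: Lspace_measurable.
- by move=> x; rewrite (le_trans (ler_normrM_sg _ _))// normr_id.
by exists k => //; exact: sign_duality_mapping.
Qed.

(** An element of [J(f)] attains equality in Hölder's inequality, which
    determines it wherever [f] does not vanish. *)
Lemma duality_mapping_sign f k : (\forall x \ae mu, (f : T -> R) x != 0) ->
  duality_mapping f k ->
  (k : T -> R) = (fun x => `|f| * Num.sg ((f : T -> R) x)) %[ae mu].
Proof.
move=> f0 [kf fk].
have {}fk : `|f| = `|k| by apply/eqP; rewrite -(@eqrXn2 _ 2)//; exact/eqP.
have /holder_eq : pairing k f = `|k| * `|f| by rewrite kf -fk expr2.
rewrite -fk; apply: filterS2 f0 => x fx kfx _; apply: (mulIf fx).
by rewrite kfx -mulrA -normrEsg.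
Qed.

(** * The Mordukhovich derivative of the duality mapping *)

(** The nonpositivity of the upper limit, in the form in which it is tested on
    points of the graph of the duality mapping. *)
Lemma mordukhovich_derivative_quotient_le f k0 gamma k :
  mordukhovich_derivative f k0 gamma k -> forall e, 0 < e ->
  exists2 r, 0 < r & forall g l, duality_mapping g l -> (g, l) != (f, k0) ->
    `|g - f| < r -> `|l - k0| < r ->
    difference_quotient f k0 gamma k (g, l) <= e.
Proof.
move=> D e e0.
have /ereal_inf_lt[_ [V + <-] Ve] :
  (limf_esup (EFin \o difference_quotient f k0 gamma k)
     (within [set z | duality_mapping z.1 z.2] (f, k0)^') < e%:E)%E.
  by apply: le_lt_trans D _; rewrite lte_fin.
move=> /nbhs_ballP[r /= r0 rV]; exists r => // g l gl neq gf lk.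
rewrite -lee_fin (le_trans _ (ltW Ve))//; apply: ereal_sup_ubound.
exists (g, l) => //; apply: rV => //=.
by split; rewrite /= -ball_normE /= distrC.
Qed.

(** The test points are g = f + t h with ‖g‖ sgn g in J(g): since [g] and [f]
    have the same sign, the displacement in Linfty is at most the displacement
    t ‖h‖ in L1.  If <k, h> were positive, the difference quotient would be at
    least <k, h> / (2 ‖h‖) for arbitrarily small t. *)
Lemma mordukhovich_derivative0_pairing_le0 f k0 k h :
  (k0 : T -> R) = (fun x => `|f| * Num.sg ((f : T -> R) x)) %[ae mu] ->
  mordukhovich_derivative f k0 0 k ->
  (\forall x \ae mu, `|(h : T -> R) x| <= `|(f : T -> R) x|) ->
  pairing k h <= 0.
Proof.
move=> k0E D hf; rewrite leNgt; apply/negP => kh0.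
have h0 : 0 < `|h|.
  rewrite lt0r normr_ge0 andbT; apply/eqP => h0.
  by have := pairing_le k h; rewrite h0 mulr0 leNgt kh0.
(* The tested bound <k, h> / (3 ‖h‖) is below <k, h> / (2 ‖h‖). *)
have e0 : 0 < pairing k h / (3 * `|h|) by rewrite divr_gt0// mulr_gt0.
have [r r0 Dr] := mordukhovich_derivative_quotient_le D e0.
have [t /andP[t0 t1] tr] : exists2 t, 0 < t < 1 & t * `|h| < r.
  exists (Num.min 2^-1 (r / (2 * `|h|))).
    rewrite lt_min invr_gt0 ltr0n divr_gt0 ?mulr_gt0//=.
    by rewrite (@le_lt_trans _ _ 2^-1) ?ge_min ?lexx// invf_lt1 ?ltr1n.
  rewrite (@le_lt_trans _ _ (r / (2 * `|h|) * `|h|))//.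
    by rewrite ler_pM2r// ge_min lexx orbT.
  by rewrite invfM mulrA mulfVK ?gt_eqF// ltr_pdivrMr// ltr_pMr// ltr1n.
set g := f + t *: h.
have gf : g - f = t *: h by rewrite /g addrAC subrr add0r.
have ngf : `|g - f| = t * `|h| by rewrite gf normrZ gtr0_norm.
have [l gl lE] := exists_sign_duality_mapping g.
have lk : `|l - k0| <= t * `|h|.
  rewrite -ngf; apply: (le_trans _ (ler_dist_dist g f)).
  apply: Linfty_norm_le => //.
  have gE := ae_conj (Lspace_add_ae f (t *: h)) (Lspace_scale_ae t h).
  have lkE := ae_conj (Lspace_add_ae l (- k0)) (Lspace_opp_ae k0).
  have signs := ae_conj lE k0E.
  have sums := ae_conj gE lkE.
  move: sums signs hf; apply: filterS3 => x [[g1 g2] [l1 l2]] [l3 l4] hfx.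
  rewrite l1//= l2//= (l3 I) (l4 I) g1//= g2//= sgr_perturb//; last by rewrite ltW.
  by rewrite -mulrBl ler_normrM_sg.
have th0 : 0 < t * `|h| by rewrite mulr_gt0.
have gneq : (g, l) != (f, k0).
  apply/eqP => -[gf0 _]; move: th0.
  by rewrite -ngf gf0 subrr normr0 ltxx.
have lkr : `|l - k0| < r by exact: le_lt_trans lk tr.
have := Dr g l gl gneq; rewrite ngf => /(_ tr lkr).
rewrite /difference_quotient dual_zeroE subr0 /= gf pairingZr -gf ngf.
have den0 : 0 < t * `|h| + `|l - k0| by rewrite ltr_wpDr.
rewrite ler_pdivrMr//; apply/negP; rewrite -ltNge.
apply: (@le_lt_trans _ _ (pairing k h / (3 * `|h|) * (t * `|h| + t * `|h|))).
  by rewrite ler_pM2l ?divr_gt0 ?mulr_gt0// lerD2l.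
have -> : pairing k h / (3 * `|h|) * (t * `|h| + t * `|h|) =
    t * pairing k h * (2 / 3).
  by field; rewrite gt_eqF.
by rewrite gtr_pMr ?mulr_gt0// ltr_pdivrMr// mul1r ltr_nat.
Qed.

End L1_Linfty_theory.

Theorem theorem4p5 (R : realType) (d : measure_display) (S : measurableType d)
    (mu : {measure set S -> \bar R})
    (mu_complete : measure_is_complete mu)
    (L1_dual : dual_L1_is_Linfty mu)
    (L1_nonreflexive : ~ reflexive_space (L1 mu))
    (Linfty_nonreflexive : ~ reflexive_space (Linfty mu))
    (f : L1 mu) (f_neq0 : mu [set s : S | f s = 0] = 0%E) :
  exists f' : Linfty mu,
    duality_mapping f = [set f'] /\
    mordukhovich_derivative f f' (0 : dual (Linfty mu)) = [set (0 : Linfty mu)].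
Proof.
have f0 : \forall x \ae mu, (f : S -> R) x != 0.
  exists [set s | f s = 0]; split => //.
    have := (Lspace_measurable f) measurableT _ (@measurable_set1 R 0).
    by rewrite setTI.
  by move=> x /= /negP; rewrite negbK => /eqP.
have [f' ff' f'E] := exists_sign_duality_mapping f.
exists f'; split; apply/seteqP; split => [k /=|k /= ->].
- move=> /(duality_mapping_sign f0) kE; apply/Lspace_eqP.
  exact: ae_eq_trans kE (ae_eq_sym f'E).
- exact: ff'.
- move=> D.
  (* The test direction |f| sgn k pairs with k to the integral of |k f|. *)
  have u_meas : measurable_fun setT (fun x => `|(f : S -> R) x| * Num.sg ((k : S -> R) x)).
    apply: measurable_funM; last exact: measurable_sgr (Lspace_measurable k).
    by apply: measurableT_comp => //; exact: Lspace_measurable.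
  have u_le x : `| `|(f : S -> R) x| * Num.sg ((k : S -> R) x)| <= `|(f : S -> R) x|.
    by rewrite (le_trans (ler_normrM_sg _ _))// normr_id.
  have [h hE] := dominated_L1 u_meas u_le.
  have kh : \forall x \ae mu,
      (k : S -> R) x * (h : S -> R) x = `|(k : S -> R) x * (f : S -> R) x|.
    apply: filterS hE => x /(_ I) ->.
    by rewrite mulrCA [_ * Num.sg _]mulrC -normrEsg normrM mulrC.
  have kh_ge0 : \forall x \ae mu, 0 <= (k : S -> R) x * (h : S -> R) x.
    by apply: filterS kh => x ->.
  have /le_anti kh0 : pairing k h <= 0 <= pairing k h.
    rewrite (ae_Rintegral_ge0 (pairing_integrable k h) kh_ge0) andbT.
    apply: (mordukhovich_derivative0_pairing_le0 f'E D).
    by apply: filterS hE => x /(_ I) ->.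
  have := ae_Rintegral_eq0 (pairing_integrable k h) kh_ge0 kh0.
  move=> khz; apply/Lspace_eqP.
  have Z := ae_conj khz (Lspace_zero_ae mu (leey 1%:E)).
  have Z' := ae_conj f0 kh.
  move: Z Z'; apply: filterS2 => x [e1 e2] [e3 e4] _.
  rewrite e2//=; apply/eqP; move: e4; rewrite e1//= => /esym/eqP.
  by rewrite normr_eq0 mulf_eq0 (negbTE e3) orbF.
- rewrite /mordukhovich_derivative /=.
  apply: le_trans (ereal_inf_lbound _) _.
    by exists setT => //; exact: filterT.
  apply: ge_ereal_sup => _ [z _ <-] /=.
  by rewrite /difference_quotient dual_zeroE pairing0l subrr mul0r.
Qed.
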